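(* Let $\Omega\subset\mathbb{R}^N$ be open and bounded, $T>0$, and $Q_T=\Omega\times(0,T]$. Let $\{\mu_x\}_{x\in\Omega}$ be a family of Lévy measures such that for some constant $\tilde C_\mu>0$, $\int_B|z|^2\mu_x(dz)+\int_{\mathbb{R}^N\setminus B}\mu_x(dz)\le\tilde C_\mu$ for all $x\in\Omega$. Let $F:\Omega\times[0,T]\times\mathbb{R}^N\times\mathbb{S}^N\times\mathbb{R}\to\mathbb{R}$ be continuous and degenerate elliptic, and suppose that $F$ satisfies the nondegeneracy condition $(N)$ and the scaling condition $(S)$ given in the context. Let $u\in USC(\mathbb{R}^N\times[0,T])$ be a viscosity subsolution of $$u_t+F(x,t,Du,D^2u,\mathcal{I}[x,t,u])=0\quad\text{in }\Omega\times(0,T)$$ that attains a global maximum at $P_0=(x_0,t_0)\in Q_T$. Then $u$ is constant in $C(P_0)$, the connected component of $\Omega\times\{t_0\}$ containing $P_0$.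
   Context: $\mathbb{S}^N$ is the set of real symmetric $N\times N$ matrices, $I$ the identity matrix; $B=\{|z|<1\}\subset\mathbb{R}^N$, $1_B$ its indicator. A family of Lévy measures $\{\mu_x\}_{x\in\Omega}$ is a family of nonnegative, possibly singular, Borel measures on $\mathbb{R}^N$ with $\sup_{x\in\Omega}\int\min(|z|^2,1)\,\mu_x(dz)<\infty$. $USC(\mathbb{R}^N\times[0,T])$ is the set of upper semicontinuous real functions on $\mathbb{R}^N\times[0,T]$. Degenerate elliptic: $F(x,t,p,X,l_1)\le F(x,t,p,Y,l_2)$ whenever $X\ge Y$, $l_1\ge l_2$, for all $(x,t)$, $p\in\mathbb{R}^N\setminus\{0\}$. For $0\le\eta<1$, $\gamma>0$, $p\in\mathbb{R}^N$: $\mathcal{C}_{\eta,\gamma}(p)=\{z\in\mathbb{R}^N:\ (1-\eta)|z||p|\le|p\cdot z|\le1/\gamma\}$. $(N)$: for any $\bar x\in\Omega$ and $0<t_0<T$ there exist $R_0>0$ small enough and $0\le\eta<1$ such that for any $0<R<R_0$ and $c>0$, $$F\Big(x,t,p,I-\gamma p\otimes p,\ \tilde C_\mu-c\gamma\int_{\mathcal{C}_{\eta,\gamma}(p)}|p\cdot z|^2\mu_x(dz)\Big)\to+\infty\ \text{ as }\gamma\to+\infty,$$ uniformly for $|x-\bar x|\le R$, $|t-t_0|\le R$, $R/2\le|p|\le R$. $(S)$: for any $\bar x\in\Omega$ and $0<t_0<T$ there exist $R_0>0$, $\varepsilon_0>0$, $\gamma_0>0$ such that for all $0<R<R_0$,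 $0<\varepsilon<\varepsilon_0$, $\gamma\ge\gamma_0$, and all $|x-\bar x|\le R$, $|t-t_0|\le R$, $R/2\le|p|\le R$, $l\in\mathbb{R}$, $$F(x,t,\varepsilon p,\varepsilon(I-\gamma p\otimes p),\varepsilon l)\ge\varepsilon F(x,t,p,I-\gamma p\otimes p,l).$$ Nonlocal operator: $\mathcal{I}[x,t,u]=\int_{\mathbb{R}^N}\big(u(x+z,t)-u(x,t)-Du(x,t)\cdot z\,1_B(z)\big)\mu_x(dz)$. For $0<\delta<1$, $p\in\mathbb{R}^N$: $\mathcal{I}^1_\delta[x,t,u]=\int_{|z|\le\delta}\big(u(x+z,t)-u(x,t)-Du(x,t)\cdot z\,1_B(z)\big)\mu_x(dz)$, $\mathcal{I}^2_\delta[x,t,p,u]=\int_{|z|>\delta}\big(u(x+z,t)-u(x,t)-p\cdot z\,1_B(z)\big)\mu_x(dz)$. Viscosity subsolution: an upper semicontinuous $u:\mathbb{R}^N\times[0,T]\to\mathbb{R}$ such that for every $\phi\in C^2(\mathbb{R}^N\times[0,T])$ for which $u-\phi$ attains a global maximum at $(x,t)\in\Omega\times(0,T)$, and every $0<\delta<1$, $$\phi_t(x,t)+F\big(x,t,D\phi(x,t),D^2\phi(x,t),\mathcal{I}^1_\delta[x,t,\phi]+\mathcal{I}^2_\delta[x,t,D\phi(x,t),u]\big)\le0.$$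
   Formalization: The maximum point P_0=(x_0,t_0) is additionally required to satisfy t_0<T; at t_0=T the claim is false, since the equation is imposed only on Ω×(0,T) and an upper semicontinuous subsolution may jump up at a single point at time T. *)

(* Defs.v *)
From HB Require Import structures.
From mathcomp Require Export all_boot all_order all_algebra.
From mathcomp Require Export all_classical all_reals all_analysis.

Set Implicit Arguments.
Unset Strict Implicit.
Unset Printing Implicit Defensive.

Import Order.TTheory GRing.Theory Num.Theory.
Export numFieldNormedType.Exports.

Local Open Scope classical_set_scope.
Local Open Scope ring_scope.

(* The library norm `|z| on 'rV[R]_N is the sup norm, hence the explicit
   Euclidean norm below. *)
Definition dot (R : realType) (N : nat) (p z : 'rV[R]_N) : R :=
  \sum_(i < N) p ord0 i * z ord0 i.

Definition enorm (R : realType) (N : nat) (z : 'rV[R]_N) : R :=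
  Num.sqrt (dot z z).

Definition unit_ball (R : realType) (N : nat) : set 'rV[R]_N :=
  [set z | enorm z < 1].
Arguments unit_ball {R N}.

Definition psd (R : realType) (N : nat) (X : 'M[R]_N) : Prop :=
  forall v : 'rV[R]_N, 0 <= (v *m X *m v^T) ord0 ord0.

Definition strip (R : realType) (N : nat) (T : R) : set ('rV[R]_N * R) :=
  [set P | 0 <= P.2 <= T].

(* The terminal time is included, but horizontal propagation of a maximum is
   only claimed for t0 < T: the viscosity inequality is imposed for t < T only,
   and an u.s.c. subsolution may jump up arbitrarily at t = T. *)
Definition cylinder (R : realType) (N : nat) (Omega : set 'rV[R]_N) (T : R)
    : set ('rV[R]_N * R) :=
  [set P | Omega P.1 /\ 0 < P.2 <= T].

(* R^N with its Borel sigma-algebra. *)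
Notation borel_rV R N := (g_sigma_algebraType (@open 'rV[R]_N)).

Definition levy_family (R : realType) (N : nat) (Omega : set 'rV[R]_N)
    (mu : 'rV[R]_N -> {measure set (borel_rV R N) -> \bar R}) : Prop :=
  (ereal_sup [set \int[mu x]_z (Num.min (enorm z ^+ 2) 1)%:E | x in Omega]
     < +oo)%E.

Definition usc_on (R : realType) (U : topologicalType) (S : set U)
    (u : U -> R) : Prop :=
  forall P, S P -> forall a, u P < a ->
    \forall Q \near within S (nbhs P), u Q < a.

Definition max_on (R : realType) (U : Type) (S : set U) (f : U -> R) (P : U)
    : Prop :=
  S P /\ forall Q, S Q -> f Q <= f P.

(* C^k on S, for S the closure of its interior in a finite-dimensional space:
   the directional derivatives up to order k exist in the interior of S and
   extend to continuous functions on S. *)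
Fixpoint Ck (R : realType) (U : normedModType R) (k : nat) (S : set U)
    (f : U -> R) : Prop :=
  match k with
  | 0%N => {within S, continuous f}
  | k'.+1 => {within S, continuous f} /\
      forall v : U, exists g : U -> R,
        Ck k' S g /\ forall P, S° P -> is_derive P v f (g P)
  end.

Section Derivatives.
Context (R : realType) (N : nat).
Implicit Types (phi : 'rV[R]_N * R -> R) (P : 'rV[R]_N * R).

Definition space_dir (i : 'I_N) : 'rV[R]_N * R := (delta_mx ord0 i, 0).

Definition time_dir : 'rV[R]_N * R := (0, 1).

Definition Dt phi P : R := 'D_time_dir phi P.

Definition Dx phi P : 'rV[R]_N := \row_i 'D_(space_dir i) phi P.

Definition D2x phi P : 'M[R]_N :=
  \matrix_(i, j) 'D_(space_dir i) ('D_(space_dir j) phi) P.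

End Derivatives.

(* F is only relevant on Omega x [0,T] x R^N x S^N x R. *)
Definition continuous_operator (R : realType) (N : nat)
    (Omega : set 'rV[R]_N) (T : R)
    (F : 'rV[R]_N -> R -> 'rV[R]_N -> 'M[R]_N -> R -> R) : Prop :=
  {within [set q : 'rV[R]_N * R * 'rV[R]_N * 'M[R]_N * R |
             [/\ Omega q.1.1.1.1, 0 <= q.1.1.1.2 <= T & q.1.2^T = q.1.2]],
    continuous (fun q => F q.1.1.1.1 q.1.1.1.2 q.1.1.2 q.1.2 q.2)}.

Definition degenerate_elliptic (R : realType) (N : nat)
    (Omega : set 'rV[R]_N) (T : R)
    (F : 'rV[R]_N -> R -> 'rV[R]_N -> 'M[R]_N -> R -> R) : Prop :=
  forall x t p X Y l1 l2,
    Omega x -> 0 <= t <= T -> p != 0 -> X^T = X -> Y^T = Y ->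
    psd (X - Y) -> l2 <= l1 -> F x t p X l1 <= F x t p Y l2.

Definition slab (R : realType) (N : nat) (eta gamma : R) (p : 'rV[R]_N)
    : set 'rV[R]_N :=
  [set z | (1 - eta) * enorm z * enorm p <= `|dot p z| <= gamma^-1].

Definition hess (R : realType) (N : nat) (gamma : R) (p : 'rV[R]_N)
    : 'M[R]_N :=
  1%:M - gamma *: (p^T *m p).

(* In the next two definitions the restriction to Omega x [0,T], where F is
   defined, is void once R0 is small enough. *)
Definition near_point (R : realType) (N : nat) (Omega : set 'rV[R]_N) (T : R)
    (xb : 'rV[R]_N) (t0 r : R) (x : 'rV[R]_N) (t : R) (p : 'rV[R]_N) : Prop :=
  [/\ Omega x, 0 <= t <= T, enorm (x - xb) <= r, `|t - t0| <= r
    & r / 2 <= enorm p <= r].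

Definition nondegenerate (R : realType) (N : nat) (Omega : set 'rV[R]_N)
    (T Cmu : R) (mu : 'rV[R]_N -> {measure set (borel_rV R N) -> \bar R})
    (F : 'rV[R]_N -> R -> 'rV[R]_N -> 'M[R]_N -> R -> R) : Prop :=
  forall (xb : 'rV[R]_N) (t0 : R), Omega xb -> 0 < t0 < T ->
  exists R0 : R, 0 < R0 /\ exists eta : R, 0 <= eta < 1 /\
  forall r c : R, 0 < r < R0 -> 0 < c ->
  forall A : R, \forall gamma \near +oo, forall x t p,
    near_point Omega T xb t0 r x t p ->
    A <= F x t p (hess gamma p)
           (Cmu - c * gamma *
              \int[mu x]_(z in slab eta gamma p) (`|dot p z| ^+ 2)).

Definition scaling (R : realType) (N : nat) (Omega : set 'rV[R]_N) (T : R)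
    (F : 'rV[R]_N -> R -> 'rV[R]_N -> 'M[R]_N -> R -> R) : Prop :=
  forall (xb : 'rV[R]_N) (t0 : R), Omega xb -> 0 < t0 < T ->
  exists R0 eps0 gamma0 : R, [/\ 0 < R0, 0 < eps0, 0 < gamma0 &
  forall r eps gamma : R, 0 < r < R0 -> 0 < eps < eps0 -> gamma0 <= gamma ->
  forall x t p l, near_point Omega T xb t0 r x t p ->
    eps * F x t p (hess gamma p) l
      <= F x t (eps *: p) (eps *: hess gamma p) (eps * l)].

(* The integrand u(x+z,t) - u(x,t) - p.z 1_B(z), with P = (x,t). *)
Definition increment (R : realType) (N : nat) (u : 'rV[R]_N * R -> R)
    (P : 'rV[R]_N * R) (p z : 'rV[R]_N) : R :=
  u (P.1 + z, P.2) - u P - dot p z * \1_unit_ball z.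

Definition I1 (R : realType) (N : nat)
    (mu : 'rV[R]_N -> {measure set (borel_rV R N) -> \bar R})
    (delta : R) (P : 'rV[R]_N * R) (phi : 'rV[R]_N * R -> R) : R :=
  \int[mu P.1]_(z in [set z | enorm z <= delta]) increment phi P (Dx phi P) z.

Definition I2 (R : realType) (N : nat)
    (mu : 'rV[R]_N -> {measure set (borel_rV R N) -> \bar R})
    (delta : R) (P : 'rV[R]_N * R) (p : 'rV[R]_N) (u : 'rV[R]_N * R -> R) : R :=
  \int[mu P.1]_(z in [set z | delta < enorm z]) increment u P p z.

(* u is not assumed to be bounded below, so the integral defining I2 may
   diverge to -oo at a touching point, whereas F takes a real last argument and
   the real-valued integral of a nonintegrable function has a junk value: the
   viscosity inequality is read as including the integrability. *)
Definition viscosity_subsolution (R : realType) (N : nat)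
    (Omega : set 'rV[R]_N) (T : R)
    (mu : 'rV[R]_N -> {measure set (borel_rV R N) -> \bar R})
    (F : 'rV[R]_N -> R -> 'rV[R]_N -> 'M[R]_N -> R -> R)
    (u : 'rV[R]_N * R -> R) : Prop :=
  usc_on (strip T) u /\
  forall phi : 'rV[R]_N * R -> R, Ck 2 (strip T) phi ->
  forall P : 'rV[R]_N * R, Omega P.1 -> 0 < P.2 < T ->
    max_on (strip T) (fun Q => u Q - phi Q) P ->
  forall delta : R, 0 < delta < 1 ->
    (mu P.1).-integrable [set z | delta < enorm z]
      (fun z => (increment u P (Dx phi P) z)%:E) /\
    Dt phi P
      + F P.1 P.2 (Dx phi P) (D2x phi P)
          (I1 mu delta P phi + I2 mu delta P (Dx phi P) u) <= 0.

(* Main.v *)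
Require Import Defs.
From mathcomp Require Import ring lra measurable_realfun.
Import Order.TTheory GRing.Theory Num.Theory.
Local Open Scope classical_set_scope.
Local Open Scope ring_scope.

Set Implicit Arguments.
Unset Strict Implicit.
Unset Printing Implicit Defensive.

(** The proof is the parabolic Hopf argument adapted to jumps.  Write M for the
    maximum of u.

    Geometry.  It is enough to show that {u = M} is open within a horizontal
    slice ([local_propagation]); it is closed there by upper semicontinuity.  If
    u(x1,t0) < M with x1 close to a maximum point (x0,t0), minimise
    |x - x1|^2 + lam |t - t0|^2 over {u = M}.  For lam large the ellipsoid is so
    thin in time that the minimum is reached at a point P whose space component
    is not x1: u < M inside the ellipsoid, and P is a lateral boundary point.
    Pulling the centre towards P yields a smaller ellipsoid, with centre c, that
    touches {u = M} at P only ([ellipsoid_shrink]).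

    Barrier.  The function Q |-> - eps exp(- gam/2 |Q - c|^2), where |.| is the
    weighted norm, touches u from above, up to a constant, at a point P' that
    tends to P as eps tends to 0; the maximum of the difference is global
    because outside the ellipsoid u <= M while the function exceeds its value at
    P, and u stays below M by a positive margin in the rest of the closed
    ellipsoid ([barrier_touching]).  With e = eps gam exp(- gam/2 |P' - c|^2)
    and p the space component of P' - c, its space gradient at P' is e p, its
    Hessian e (I - gam p p^T), and its time derivative e lam times the time
    component of P' - c.

    Nonlocal term.  The increment of the barrier divided by e is the function
    [jump gam p] of z.  From exp s >= 1 + s it is at most |z|^2 in the unit ball
    and at most 1 outside; on the slab {(1-eta)|z||p| <= |p.z| <= 1/gam}, the
    inequality exp s >= 1 + s + s^2/4 for s >= -2 improves this by
    gam/16 |p.z|^2 ([jump_le]).  Since increments of u at P' are dominated by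
    those of the barrier, the nonlocal term is at most
    e (Cmu - gam/16 int_slab |p.z|^2) ([nonlocal_le]).

    Conclusion.  Ellipticity and the scaling condition turn the viscosity
    inequality at P' into the same inequality with e divided out
    ([viscosity_barrier]), and the nondegeneracy condition with c = 1/16
    contradicts it for gam large ([no_lateral_contact]). *)

(** * The Euclidean product *)

Section EuclideanProduct.
Context {R : realType} {N : nat}.
Implicit Types (p q x z : 'rV[R]_N) (k : R).

Lemma dotC p q : dot p q = dot q p.
Proof. by rewrite /dot; apply: eq_bigr => i _; rewrite mulrC. Qed.

Lemma dotDl p q z : dot (p + q) z = dot p z + dot q z.
Proof. by rewrite /dot -big_split; apply: eq_bigr => i _; rewrite mxE mulrDl. Qed.

Lemma dotZl k p z : dot (k *: p) z = k * dot p z.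
Proof. by rewrite /dot mulr_sumr; apply: eq_bigr => i _; rewrite mxE mulrA. Qed.

Lemma dot0 z : dot 0 z = 0.
Proof. by rewrite /dot big1// => i _; rewrite mxE mul0r. Qed.

Lemma enorm0 : enorm (0 : 'rV[R]_N) = 0.
Proof. by rewrite /enorm dot0 sqrtr0. Qed.

Lemma dotDr p q z : dot z (p + q) = dot z p + dot z q.
Proof. by rewrite dotC dotDl !(dotC z). Qed.

Lemma dotZr k p z : dot z (k *: p) = k * dot z p.
Proof. by rewrite dotC dotZl dotC. Qed.

Lemma dot_ge0 z : 0 <= dot z z.
Proof. by apply: sumr_ge0 => i _; rewrite -expr2 sqr_ge0. Qed.

Lemma dot_eq0 z : dot z z = 0 -> z = 0.
Proof.
move=> /eqP; rewrite psumr_eq0 => [/allP h|i _]; last by rewrite -expr2 sqr_ge0.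
apply/rowP => i; have := h i; rewrite mem_index_enum => /(_ isT)/=.
by rewrite mulf_eq0 orbb mxE => /eqP.
Qed.

Lemma sqr_enorm z : enorm z ^+ 2 = dot z z.
Proof. by rewrite sqr_sqrtr ?dot_ge0. Qed.

Lemma enorm_ge0 z : 0 <= enorm z.
Proof. exact: sqrtr_ge0. Qed.

Lemma enorm_gt0 z : z != 0 -> 0 < enorm z.
Proof.
move=> z0; rewrite lt_neqAle enorm_ge0 andbT eq_sym; apply: contra z0 => /eqP h.
by apply/eqP/dot_eq0; rewrite -sqr_enorm h expr0n.
Qed.

Lemma enormZ k z : enorm (k *: z) = `|k| * enorm z.
Proof.
rewrite /enorm dotZl dotZr mulrA -expr2 sqrtrM ?sqr_ge0//.
by rewrite sqrtr_sqr.
Qed.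

Lemma dot_delta p (i : 'I_N) : dot p (delta_mx ord0 i) = p ord0 i.
Proof.
rewrite /dot (bigD1 i)//= big1 ?addr0 => [|j ji].
  by rewrite mxE !eqxx mulr1.
by rewrite mxE (negbTE ji) andbF mulr0.
Qed.

Lemma coord_le_enorm z (i : 'I_N) : `|z ord0 i| <= enorm z.
Proof.
rewrite -(@ler_pXn2r _ 2) ?nnegrE ?enorm_ge0// sqr_enorm real_normK ?num_real//.
rewrite /dot (bigD1 i)//= -expr2 lerDl.
by apply: sumr_ge0 => j _; rewrite -expr2 sqr_ge0.
Qed.

Lemma norm_le_enorm z : `|z| <= enorm z.
Proof.
have [->|/mx_norm_neq0[[i j]/= h]] := eqVneq `|z| 0; first exact: enorm_ge0.
by rewrite [leLHS]h (ord1 i) coord_le_enorm.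
Qed.

(** The constant need not be the optimal one, enorm p. *)
Lemma dot_le_enorm p : exists2 C : R, 0 <= C &
  forall z, `|dot p z| <= C * enorm z.
Proof.
exists (\sum_i `|p ord0 i|) => [|z]; first exact: sumr_ge0.
rewrite mulr_suml; apply: le_trans (ler_norm_sum _ _ _) _.
by apply: ler_sum => i _; rewrite normrM ler_wpM2l// coord_le_enorm.
Qed.

Lemma dot_continuous p : continuous (dot p).
Proof.
apply: (@continuous_big R _ _ _ _ (@add_continuous R)) => i _ z.
by apply: continuousM; [exact: cst_continuous|exact: coord_continuous].
Qed.

Lemma sqdot_continuous : continuous (fun z : 'rV[R]_N => dot z z).
Proof.
apply: (@continuous_big R _ _ _ _ (@add_continuous R)) => i _ z.
by apply: continuousM; exact: coord_continuous.
Qed.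

Lemma enorm_continuous : continuous (@enorm R N).
Proof.
move=> z; apply: (@continuous_comp _ _ _ (fun z => dot z z) Num.sqrt).
  exact: sqdot_continuous.
exact: sqrt_continuous.
Qed.

Lemma dist_fst_continuous x :
  continuous (fun Q : 'rV[R]_N * R => enorm (Q.1 - x)).
Proof.
move=> Q; apply: (@continuous_comp _ _ _ (fun Q : 'rV[R]_N * R => Q.1 - x)
  (@enorm R N)); last exact: enorm_continuous.
by apply: continuousB; [exact: cvg_fst|exact: cst_continuous].
Qed.

End EuclideanProduct.

(** * The space-time barrier and its derivatives *)

Section WeightedProduct.
Context {R : realType} {N : nat} (lam : R).
Implicit Types (a b c : 'rV[R]_N * R) (k : R).

(** The inner product of space-time in which the ellipsoids
    |x - x1|^2 + lam |t - t1|^2 <= k are the balls. *)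
Definition wdot (lam : R) a b : R := dot a.1 b.1 + lam * (a.2 * b.2).

Lemma wdotC a b : wdot lam a b = wdot lam b a.
Proof. by rewrite /wdot dotC (mulrC a.2). Qed.

Lemma wdotDl a b c : wdot lam (a + b) c = wdot lam a c + wdot lam b c.
Proof. by rewrite /wdot dotDl/=; ring. Qed.

Lemma wdotZl k a c : wdot lam (k *: a) c = k * wdot lam a c.
Proof. by rewrite /wdot dotZl/= /GRing.scale/=; ring. Qed.

Lemma wdotDr a b c : wdot lam c (a + b) = wdot lam c a + wdot lam c b.
Proof. by rewrite wdotC wdotDl !(wdotC c). Qed.

Lemma wdotZr k a c : wdot lam c (k *: a) = k * wdot lam c a.
Proof. by rewrite wdotC wdotZl wdotC. Qed.

Context (lam0 : 0 < lam).

Lemma wdot_ge0 a : 0 <= wdot lam a a.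
Proof. by rewrite addr_ge0 ?dot_ge0// -expr2 mulr_ge0 ?sqr_ge0// ltW. Qed.

Lemma wdot_eq0 a : wdot lam a a = 0 -> a = 0.
Proof.
move=> h; have h2 : 0 <= lam * (a.2 * a.2) by rewrite -expr2 mulr_ge0 ?sqr_ge0// ltW.
have h1 := dot_ge0 a.1; rewrite /wdot in h.
have /dot_eq0 a1 : dot a.1 a.1 = 0 by lra.
have /eqP : lam * (a.2 * a.2) = 0 by lra.
rewrite mulf_eq0 gt_eqF//= mulf_eq0 orbb => /eqP a2.
by rewrite (surjective_pairing a) a1 a2.
Qed.

Lemma wdot0 a : wdot lam 0 a = 0.
Proof. by rewrite /wdot dot0 mul0r mulr0 addr0. Qed.

Lemma sqwdotD a b :
  wdot lam (a + b) (a + b) = wdot lam a a + 2 * wdot lam a b + wdot lam b b.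
Proof. by rewrite wdotDl !wdotDr (wdotC b); ring. Qed.

Lemma wdot_continuous c a : continuous (fun Q : 'rV[R]_N * R => wdot lam (Q - c) a).
Proof.
move=> Q; apply: (@continuousD _ _ _ (fun Q : 'rV[R]_N * R => dot (Q - c).1 a.1)
  (fun Q : 'rV[R]_N * R => lam * ((Q - c).2 * a.2))).
  rewrite (_ : (fun Q : 'rV[R]_N * R => _) =
    dot a.1 \o (fun Q : 'rV[R]_N * R => Q.1 - c.1)); last first.
    by apply/funext => z /=; rewrite dotC.
  apply: continuous_comp; last exact: dot_continuous.
  by apply: continuousB; [exact: cvg_fst|exact: cst_continuous].
apply: (@continuousM _ _ (cst lam) _ Q); first exact: cst_continuous.
apply: (@continuousM _ _ (fun Q : 'rV[R]_N * R => Q.2 - c.2) (cst a.2) Q);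
  last exact: cst_continuous.
by apply: continuousB; [exact: cvg_snd|exact: cst_continuous].
Qed.

Lemma sqwdot_continuous c :
  continuous (fun Q : 'rV[R]_N * R => wdot lam (Q - c) (Q - c)).
Proof.
move=> Q; apply: (@continuousD _ _ _ (fun Q : 'rV[R]_N * R => dot (Q - c).1 (Q - c).1)
  (fun Q : 'rV[R]_N * R => lam * ((Q - c).2 * (Q - c).2))).
  apply: (@continuous_comp _ _ _ (fun Q : 'rV[R]_N * R => Q.1 - c.1)
    (fun z => dot z z)).
    by apply: continuousB; [exact: cvg_fst|exact: cst_continuous].
  exact: sqdot_continuous.
apply: (@continuousM _ _ (cst lam) _ Q); first exact: cst_continuous.
have h : {for Q, continuous (fun Q : 'rV[R]_N * R => Q.2 - c.2)}.
  by apply: continuousB; [exact: cvg_snd|exact: cst_continuous].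
exact: (continuousM h h).
Qed.

End WeightedProduct.

(** Directional derivatives are computed along the line h |-> P + h w. *)
Lemma is_derive_line {R : realType} {V : normedModType R} (f : V -> R) P w l :
  is_derive (0 : R) 1 (fun h => f (h *: w + P)) l -> is_derive P w f l.
Proof.
case=> d1 d2; have d : derivable f P w by apply/derivable1P.
split => //; rewrite -d2 /derive.
set g1 := fun h => h^-1 *: _; set g2 := fun h => h^-1 *: _.
suff -> : g1 = g2 by [].
by rewrite funeqE /g1 /g2 => h /=; rewrite addr0 scale0r add0r [_%:A]mulr1.
Qed.

Section Barrier.
Context {R : realType} {N : nat} (gam lam : R) (c : 'rV[R]_N * R).
Implicit Types (P Q w : 'rV[R]_N * R).

(** A Gaussian centred at [c]; the factor 1/2 makes its space Hessian
    proportional to - (I - gam p p^T). *)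
Definition bump Q : R := expR (- (gam / 2) * wdot lam (Q - c) (Q - c)).

Lemma bump_gt0 Q : 0 < bump Q.
Proof. exact: expR_gt0. Qed.

Lemma bump_continuous : continuous bump.
Proof.
move=> Q; apply: (@continuous_comp _ _ _
  (fun Q : 'rV[R]_N * R => - (gam / 2) * wdot lam (Q - c) (Q - c)) (@expR R)).
  by apply: continuousM; [exact: cst_continuous|exact: sqwdot_continuous].
exact: continuous_expR.
Qed.

Lemma is_derive_wdot P w b :
  is_derive P w (fun Q : 'rV[R]_N * R => wdot lam (Q - c) b) (wdot lam w b).
Proof.
apply: is_derive_line.
rewrite (_ : (fun _ => _) = (fun h => wdot lam w b * h + wdot lam (P - c) b)).
  apply: is_derive_eq.
  by rewrite /= /GRing.scale/= !(mulr0, addr0, add0r, mul0r, mulr1).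
by apply/funext => h; rewrite -addrA !wdotDl wdotZl mulrC.
Qed.

Lemma is_derive_bump P w :
  is_derive P w bump (- gam * wdot lam (P - c) w * bump P).
Proof.
apply: is_derive_line.
rewrite /bump; set A := wdot lam w w; set B := wdot lam (P - c) w.
set C := wdot lam (P - c) (P - c); pose v := P - c.
rewrite (_ : (fun _ => _) =
    expR \o (fun h => - (gam / 2) * (A * (h * h) + 2 * B * h + C))).
  apply: is_derive_eq => /=.
  rewrite /bump -/B -/C /GRing.scale/=.
  rewrite !(mulr0, addr0, add0r, mul0r, mulr1).
  by field.
apply/funext => h/=; congr expR; congr (_ * _).
have -> : h *: w + P - c = h *: w + v by rewrite addrA.
by rewrite sqwdotD wdotZl wdotZr wdotZl (wdotC lam w v); rewrite /A /B /C /v; ring.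
Qed.

(** The test function: negative, with its minimum at [c], and increasing with
    the distance to [c]. *)
Definition barrier (eps : R) Q : R := - eps * bump Q.

(** The factor common to all derivatives of [barrier]. *)
Definition bscale (eps : R) Q : R := eps * gam * bump Q.

Lemma is_derive_barrier eps P w :
  is_derive P w (barrier eps) (bscale eps P * wdot lam (P - c) w).
Proof.
apply: is_derive_eq (is_deriveZ (- eps) (is_derive_bump P w)) _.
by rewrite /bscale /GRing.scale/=; ring.
Qed.

Lemma is_derive_barrier2 eps P w w' :
  is_derive P w' (fun Q : 'rV[R]_N * R => bscale eps Q * wdot lam (Q - c) w)
    (bscale eps P *
      (wdot lam w w' - gam * wdot lam (P - c) w * wdot lam (P - c) w')).
Proof.
have h1 := is_derive_bump P w'; have h2 := is_derive_wdot P w' w.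
have h3 := is_deriveM (is_deriveZ (eps * gam) h1) h2.
apply: is_derive_eq h3 _.
rewrite /bscale /= (wdotC lam w w').
transitivity (eps * gam * bump P * wdot lam w' w +
  wdot lam (P - c) w * (eps * gam * (- gam * wdot lam (P - c) w' * bump P))).
  by [].
by ring.
Qed.

Lemma barrier_continuous eps : continuous (barrier eps).
Proof.
by move=> Q; apply: (@continuousM _ _ (cst (- eps)) bump Q);
  [exact: cst_continuous|exact: bump_continuous].
Qed.

Lemma bscale_continuous eps : continuous (bscale eps).
Proof.
by move=> Q; apply: (@continuousM _ _ (cst (eps * gam)) bump Q);
  [exact: cst_continuous|exact: bump_continuous].
Qed.

Lemma barrier_C2 eps (S : set ('rV[R]_N * R)) : Ck 2 S (barrier eps).
Proof.
split; first exact/continuous_subspaceT/barrier_continuous.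
move=> w; exists (fun Q : 'rV[R]_N * R => bscale eps Q * wdot lam (Q - c) w).
split; last by move=> P _; exact: is_derive_barrier.
split.
  apply/continuous_subspaceT => Q.
  by apply: continuousM; [exact: bscale_continuous|exact: wdot_continuous].
move=> w'; eexists; split; last by move=> P _; exact: is_derive_barrier2.
apply/continuous_subspaceT => P.
apply: continuousM; first exact: bscale_continuous.
apply: continuousB; first exact: cst_continuous.
apply: continuousM; last exact: wdot_continuous.
by apply: continuousM; [exact: cst_continuous|exact: wdot_continuous].
Qed.

Lemma Dx_barrier eps P :
  Dx (barrier eps) P = bscale eps P *: (P - c).1.
Proof.
apply/rowP => i; rewrite !mxE (@derive_val _ _ _ _ _ _ _ (is_derive_barrier _ _ _)).
by rewrite /wdot dot_delta/= !mulr0 addr0 !mxE.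
Qed.

Lemma Dt_barrier eps P :
  Dt (barrier eps) P = bscale eps P * (lam * (P - c).2).
Proof.
rewrite /Dt (@derive_val _ _ _ _ _ _ _ (is_derive_barrier _ _ _)).
by rewrite /wdot/= dotC dot0 add0r mulr1.
Qed.

Lemma D2x_barrier eps P :
  D2x (barrier eps) P = bscale eps P *: hess gam (P - c).1.
Proof.
apply/matrixP => i j; rewrite !mxE.
rewrite (_ : 'D_(space_dir R j) (barrier eps) =
  fun Q : 'rV[R]_N * R => bscale eps Q * wdot lam (Q - c) (space_dir R j)); last first.
  by apply/funext => Q; rewrite (@derive_val _ _ _ _ _ _ _ (is_derive_barrier _ _ _)).
rewrite (@derive_val _ _ _ _ _ _ _ (is_derive_barrier2 _ _ _ _)).
rewrite /wdot !dot_delta/= !mulr0 !addr0 big_ord1 !mxE !eqxx/= eq_sym.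
by congr (_ * (_ - _)); rewrite -!mulrA (mulrC (_ - _)).
Qed.

(** The increment of the barrier from P to P + (z,0), compensated in the unit
    ball and divided by [bscale]: it depends on P only through the space
    component [p] of P - c. *)
Definition jump (p z : 'rV[R]_N) : R :=
  (1 - expR (- (gam / 2) * (2 * dot p z + dot z z))) / gam - dot p z * \1_unit_ball z.

Lemma increment_barrier eps P z : gam != 0 ->
  increment (barrier eps) P (Dx (barrier eps) P) z
    = bscale eps P * jump (P - c).1 z.
Proof.
move=> g0; rewrite /increment Dx_barrier dotZl /barrier /jump /bscale.
have -> : bump (P.1 + z, P.2) =
    bump P * expR (- (gam / 2) * (2 * dot (P - c).1 z + dot z z)).
  rewrite /bump -expRD; congr expR; rewrite -mulrDr; congr (_ * _).
  have -> : (P.1 + z, P.2) - c = (P - c) + (z, 0).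
    by apply/pair_equal_spec; split; rewrite /= ?addr0 // addrAC.
  by rewrite sqwdotD {2 3}/wdot /= !mulr0 !addr0; ring.
by field.
Qed.

End Barrier.

(** * Pointwise bounds on the jumps of the barrier *)

Section JumpBounds.
Context {R : realType} {N : nat}.
Implicit Types (s gam eta : R) (p z : 'rV[R]_N).

(** Square 1 + s/2 <= exp(s/2); the bound -2 makes the left side nonnegative. *)
Lemma expR_ge_quadratic s : -2 <= s -> 1 + s + s ^+ 2 / 4 <= expR s.
Proof.
move=> s2; have h : 0 <= 1 + s / 2 by lra.
have -> : expR s = expR (s / 2) * expR (s / 2).
  by rewrite -expRD; congr expR; field.
by have := expR_ge1Dx (s / 2); nra.
Qed.

(** From exp(s) (1 - s) <= 1. *)
Lemma expR_le_quadratic s : `|s| <= 1 / 2 -> expR s <= 1 + s + 2 * s ^+ 2.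
Proof.
rewrite ler_norml => /andP[s1 s2].
have h := expR_ge1Dx (- s); have e0 := expR_gt0 s.
have he : expR s * expR (- s) = 1 by rewrite -expRD subrr expR0.
have : expR s * (1 - s) <= 1 by rewrite -[leRHS]he ler_wpM2l// ltW.
have : 1 <= (1 + s + 2 * s ^+ 2) * (1 - s).
  rewrite (_ : _ * _ = 1 + s ^+ 2 * (1 - 2 * s)); last by ring.
  by rewrite lerDl mulr_ge0 ?sqr_ge0//; lra.
move=> h1 h2; have : expR s * (1 - s) <= (1 + s + 2 * s ^+ 2) * (1 - s) by lra.
by rewrite ler_pM2r//; lra.
Qed.

(** The weight in the bound on the Levy measures: |z|^2 in the unit ball and 1
    outside. *)
Definition levy_weight z : R := if enorm z < 1 then enorm z ^+ 2 else 1.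

Lemma levy_weight_ge0 z : 0 <= levy_weight z.
Proof. by rewrite /levy_weight; case: ifP => // _; rewrite sqr_ge0. Qed.

(** The integrand of the nondegeneracy condition, extended by 0. *)
Definition slab_energy eta gam p z : R :=
  `|dot p z| ^+ 2 * \1_(slab eta gam p) z.

(** For large [gam] the slab lies in the unit ball, and so close to the origin
    that |z|^2 is dominated by |p.z|. *)
Lemma slab_small eta gam p z : 0 < gam ->
  1 <= gam * ((1 - eta) * enorm p) ^+ 2 -> 1 < gam * ((1 - eta) * enorm p) ->
  slab eta gam p z -> enorm z < 1 /\ enorm z ^+ 2 <= `|dot p z|.
Proof.
move=> g0; set k := (1 - eta) * enorm p => h1 h2 /andP[h3 h4].
have z0 := enorm_ge0 z; have k0 : 0 < k by nra.
have h5 : enorm z * k <= `|dot p z| by rewrite mulrC /k mulrAC.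
have h6 : gam * `|dot p z| <= 1 by rewrite mulrC -ler_pdivlMr// div1r.
have h7 : gam * (enorm z * k) <= 1 by nra.
have h8 : enorm z < 1.
  rewrite ltNge; apply/negP => h.
  have : gam * k * 1 <= gam * k * enorm z by rewrite ler_wpM2l// mulr_ge0// ltW.
  by nra.
split=> //; have h9 : enorm z <= k.
  have : gam * (enorm z * k) <= gam * k ^+ 2 by lra.
  by rewrite ler_pM2l// expr2 ler_pM2r.
by apply: le_trans h5; rewrite expr2 ler_wpM2l.
Qed.

(** With a = 2 p.z + |z|^2 and s = - gam a / 2, the inequality exp s >= 1 + s
    gives the bound by [levy_weight].  On the slab, |p.z| <= |a| and
    |gam a| <= 3, so the quadratic term of exp is available. *)
Lemma jump_le eta gam p z : 1 <= gam ->
  1 <= gam * ((1 - eta) * enorm p) ^+ 2 -> 1 < gam * ((1 - eta) * enorm p) ->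
  jump gam p z <= levy_weight z - gam / 16 * slab_energy eta gam p z.
Proof.
move=> g1 h1 h2; have g0 : 0 < gam by lra.
rewrite /jump /levy_weight /slab_energy !indicE -sqr_enorm.
set d := dot p z; set s := - (gam / 2) * _; set e := expR s.
have zz : 0 <= enorm z ^+ 2 by rewrite sqr_ge0.
have [|hn] := boolP (z \in slab eta gam p); last first.
  rewrite mulr0 mulr0 subr0.
  have [hB|hB] := ltP (enorm z) 1.
    rewrite mem_set// mulr1 lerBlDr ler_pdivrMr//.
    by have := expR_ge1Dx s; rewrite -/e /s; nra.
  rewrite memNset ?mulr0 ?subr0; last by apply/negP; rewrite -leNgt.
  by rewrite ler_pdivrMr// mul1r; have := expR_gt0 s; rewrite -/e; lra.
move=> /set_mem hs; have [hB hz] := slab_small g0 h1 h2 hs.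
move: hs => /andP[_]; rewrite -/d => h4.
have h6 : gam * `|d| <= 1 by rewrite mulrC -ler_pdivlMr// div1r.
rewrite hB mem_set// !mulr1 lerBlDr ler_pdivrMr//.
have d2 : `|d| ^+ 2 = d ^+ 2 by rewrite real_normK ?num_real.
have [dlo dhi] : - `|d| <= d /\ d <= `|d| by apply/andP; rewrite -ler_norml.
have n0 := normr_ge0 d.
have h7 : gam * (2 * d + enorm z ^+ 2) <= gam * (3 * `|d|).
  by rewrite ler_wpM2l//; lra.
have hs2 : -2 <= s by rewrite /s; lra.
have := expR_ge_quadratic hs2; rewrite -/e => he.
(* |z|^2 <= |p.z| makes the square of 2 p.z + |z|^2 at least (p.z)^2. *)
have ha : `|d| ^+ 2 <= (2 * d + enorm z ^+ 2) ^+ 2.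
  rewrite d2; move: hz zz {h7}; move: (enorm z ^+ 2) => w hz zz.
  have : 0 <= (d + w) * (3 * d + w).
    case: (leP 0 d) hz => hd; [rewrite ger0_norm//|rewrite ltr0_norm//];
      rewrite -/d => hz.
      by rewrite mulr_ge0//; lra.
    by rewrite mulr_le0//; lra.
  by nra.
have hss : s ^+ 2 / 4 = gam ^+ 2 / 16 * (2 * d + enorm z ^+ 2) ^+ 2.
  by rewrite /s; field.
have : gam ^+ 2 / 16 * `|d| ^+ 2 <= s ^+ 2 / 4.
  by rewrite hss ler_wpM2l// divr_ge0 ?sqr_ge0.
move=> hq; have : 1 - e <= - s - gam ^+ 2 / 16 * `|d| ^+ 2 by lra.
by rewrite /s; nra.
Qed.

(** Compensated increments of the barrier are bounded below by a multiple of
    |z|^2 near the origin. *)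
Lemma jump_ge gam p : 0 < gam -> exists delta C : R, [/\ 0 < delta, delta < 1, 0 <= C &
  forall z, enorm z <= delta -> - C * enorm z ^+ 2 <= jump gam p z].
Proof.
move=> g0; have [K K0 hK] := dot_le_enorm p.
(* This choice gives |gam (2 p.z + |z|^2) / 2| <= 1/2 for |z| <= delta. *)
set delta := Num.min (1 / 2) (1 / (gam * (2 * K + 1))).
have gK : 0 < gam * (2 * K + 1) by rewrite mulr_gt0//; lra.
exists delta, (gam * (2 * K + 1) ^+ 2 / 2); split.
- by rewrite lt_min divr_gt0// divr_gt0.
- by rewrite gt_min; apply/orP; left; lra.
- by rewrite divr_ge0// mulr_ge0 ?sqr_ge0// ltW.
move=> z; rewrite le_min => /andP[z1 z2]; have z0 := enorm_ge0 z.
move: z2; rewrite ler_pdivlMr// => z2.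
rewrite /jump indicE mem_set ?mulr1 -?sqr_enorm; last by rewrite /unit_ball/=; lra.
have := hK z; set d := dot p z; rewrite ler_norml => /andP[d1 d2].
set s := - (gam / 2) * _.
have hs : `|s| <= gam * (2 * K + 1) * enorm z / 2.
  have ee : enorm z ^+ 2 <= enorm z by nra.
  have ee0 : 0 <= enorm z ^+ 2 by rewrite sqr_ge0.
  have h1 : gam * (2 * d + enorm z ^+ 2) <= gam * ((2 * K + 1) * enorm z).
    by rewrite ler_wpM2l ?(ltW g0)//; lra.
  have h2 : gam * - ((2 * K + 1) * enorm z) <= gam * (2 * d + enorm z ^+ 2).
    by rewrite ler_wpM2l ?(ltW g0)//; lra.
  by rewrite ler_norml /s; apply/andP; split; lra.
have hs2 : s ^+ 2 <= (gam * (2 * K + 1) * enorm z / 2) ^+ 2.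
  rewrite -[leLHS](@real_normK _ s) ?num_real// ler_sqr ?nnegrE//.
  by rewrite divr_ge0// mulr_ge0// ltW.
have : `|s| <= 1 / 2 by lra.
move=> /expR_le_quadratic he.
rewrite lerBrDr ler_pdivlMr//.
have : 1 - expR s >= - s - 2 * s ^+ 2 by lra.
have -> : - s = gam * d + gam / 2 * enorm z ^+ 2 by rewrite /s; field.
have -> : (- (gam * (2 * K + 1) ^+ 2 / 2) * enorm z ^+ 2 + d) * gam =
   gam * d - 2 * (gam * (2 * K + 1) * enorm z / 2) ^+ 2 by field.
have : 0 <= gam / 2 * enorm z ^+ 2 by rewrite mulr_ge0 ?sqr_ge0// divr_ge0// ltW.
lra.
Qed.

End JumpBounds.

(** * Measurability and the nonlocal term *)

Section Measurability.
Context {R : realType} {N : nat}.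
Implicit Types (p z : 'rV[R]_N).

Lemma measurable_continuous (f : 'rV[R]_N -> R) : continuous f ->
  measurable_fun setT (f : borel_rV R N -> R).
Proof.
move=> /continuousP cf; apply: (measurability _ (RGenOpens.measurableE R)).
move=> _ [_ [a [b ->] <-]]; rewrite setTI; apply: sub_sigma_algebra.
exact/cf/interval_open.
Qed.

Lemma measurable_dot p : measurable_fun setT (dot p : borel_rV R N -> R).
Proof. by apply: measurable_continuous; exact: dot_continuous. Qed.

Lemma measurable_sqdot :
  measurable_fun setT ((fun z => dot z z) : borel_rV R N -> R).
Proof. by apply: measurable_continuous; exact: sqdot_continuous. Qed.

Lemma measurable_enorm : measurable_fun setT (@enorm R N : borel_rV R N -> R).
Proof. by apply: measurable_continuous; exact: enorm_continuous. Qed.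

Lemma measurable_le_set (f g : borel_rV R N -> R) :
  measurable_fun setT f -> measurable_fun setT g ->
  measurable [set z | f z <= g z].
Proof.
by move=> mf mg; rewrite -[X in measurable X]setTI; exact: measurable_fun_le.
Qed.

Lemma measurable_lt_set (f g : borel_rV R N -> R) :
  measurable_fun setT f -> measurable_fun setT g ->
  measurable [set z | f z < g z].
Proof.
move=> mf mg; rewrite -[X in measurable X]setTI.
by apply: (measurable_fun_ltr mf mg _ (Y := [set true])) => //.
Qed.

Lemma measurable_unit_ball : measurable (unit_ball : set (borel_rV R N)).
Proof.
apply: (measurable_lt_set (g := cst 1)); first exact: measurable_enorm.
exact: measurable_cst.
Qed.

Lemma measurable_slab eta gam p : measurable (slab eta gam p : set (borel_rV R N)).
Proof.
have md : measurable_fun setT ((fun z => `|dot p z|) : borel_rV R N -> R).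
  apply: (@measurableT_comp _ _ _ _ _ _ (@Num.norm _ R)); first exact: normr_measurable.
  exact: measurable_dot.
have -> : slab eta gam p = [set z | (1 - eta) * enorm z * enorm p <= `|dot p z|]
    `&` [set z | `|dot p z| <= gam^-1].
  by apply/seteqP; split => z /andP.
apply: measurableI.
  apply: (measurable_le_set _ md).
  apply: measurable_funM; last exact: measurable_cst.
  by apply: measurable_funM; [exact: measurable_cst|exact: measurable_enorm].
by apply: (measurable_le_set md); exact: measurable_cst.
Qed.

Lemma measurable_levy_weight :
  measurable_fun setT (@levy_weight R N : borel_rV R N -> R).
Proof.
apply: measurable_fun_ifT; last exact: measurable_cst.
  apply: measurable_fun_ltr; last exact: measurable_cst.
  exact: measurable_enorm.
by apply: measurable_funX; exact: measurable_enorm.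
Qed.

Lemma measurable_slab_energy eta gam p :
  measurable_fun setT (slab_energy eta gam p : borel_rV R N -> R).
Proof.
apply: measurable_funM; last first.
  by apply: measurable_indic; exact: measurable_slab.
apply: measurable_funX.
apply: (@measurableT_comp _ _ _ _ _ _ (@Num.norm _ R)); first exact: normr_measurable.
exact: measurable_dot.
Qed.

Lemma measurable_jump gam p :
  measurable_fun setT (jump gam p : borel_rV R N -> R).
Proof.
apply: measurable_funB; last first.
  apply: measurable_funM; first exact: measurable_dot.
  by apply: measurable_indic; exact: measurable_unit_ball.
apply: measurable_funM; last exact: measurable_cst.
apply: measurable_funB; first exact: measurable_cst.
apply: (@measurableT_comp _ _ _ _ _ _ (@expR R)); first exact: measurable_expR.
apply: measurable_funM; first exact: measurable_cst.
apply: measurable_funD; last exact: measurable_sqdot.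
by apply: measurable_funM; [exact: measurable_cst|exact: measurable_dot].
Qed.

End Measurability.

Section LevyIntegrals.
Context {R : realType} {N : nat} (nu : {measure set (borel_rV R N) -> \bar R}).
Context (Cmu : R).
Context (hnu : (\int[nu]_(z in unit_ball) (enorm z ^+ 2)%:E
  + \int[nu]_(z in ~` unit_ball) 1 <= Cmu%:E)%E).
Implicit Types (p z : 'rV[R]_N).

Lemma integral_levy_weight : (\int[nu]_z (levy_weight z)%:E <= Cmu%:E)%E.
Proof.
apply: le_trans hnu; rewrite -(setUv (@unit_ball R N)) ge0_integral_setU.
- rewrite le_eqVlt; apply/orP; left; apply/eqP; congr (_ + _)%E.
    apply: eq_integral => z; rewrite inE /unit_ball /levy_weight /= => -> //.
  by apply: eq_integral => z; rewrite inE /unit_ball /levy_weight /= => /negP/negbTE ->.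
- exact: measurable_unit_ball.
- by apply: measurableC; exact: measurable_unit_ball.
- by rewrite setUv; apply/measurable_EFinP; exact: measurable_levy_weight.
- by move=> z _; rewrite lee_fin levy_weight_ge0.
- by apply/disj_setPS; rewrite setICr.
Qed.

Lemma integrable_levy_weight : nu.-integrable setT (EFin \o @levy_weight R N).
Proof.
apply/integrableP; split.
  by apply/measurable_EFinP; exact: measurable_levy_weight.
under eq_integral do rewrite /= ger0_norm ?levy_weight_ge0//.
exact: le_lt_trans integral_levy_weight (ltry _).
Qed.

Lemma integrable_slab_energy eta gam p : 0 < gam ->
  1 <= gam * ((1 - eta) * enorm p) ^+ 2 -> 1 < gam * ((1 - eta) * enorm p) ->
  nu.-integrable setT (EFin \o slab_energy eta gam p).
Proof.
move=> g0 h1 h2; have [K K0 hK] := dot_le_enorm p.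
have iK := integrableZl measurableT (K ^+ 2) integrable_levy_weight.
apply: (le_integrable measurableT _ _ iK).
  by apply/measurable_EFinP; exact: measurable_slab_energy.
move=> z _; rewrite /= lee_fin /slab_energy indicE.
have w0 := levy_weight_ge0 z.
rewrite [leRHS]ger0_norm ?mulr_ge0 ?sqr_ge0//.
have [/set_mem hs|_] := boolP (_ \in _); last first.
  by rewrite mulr0 normr0 mulr_ge0 ?sqr_ge0.
have [z1 _] := slab_small g0 h1 h2 hs.
rewrite mulr1 ger0_norm ?sqr_ge0// /levy_weight z1 -exprMn.
by rewrite ler_pXn2r ?nnegrE ?mulr_ge0 ?enorm_ge0.
Qed.

(** Comparison of the two pieces of the nonlocal term with the Levy mass.  The
    lower bound on [jump] makes the first piece integrable; no lower bound is
    needed for the second one, whose integrability is assumed. *)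
Lemma nonlocal_le eta gam p e delta C (f : 'rV[R]_N -> R) :
  1 <= gam -> 1 <= gam * ((1 - eta) * enorm p) ^+ 2 ->
  1 < gam * ((1 - eta) * enorm p) -> 0 <= e -> delta < 1 -> 0 <= C ->
  (forall z, enorm z <= delta -> - C * enorm z ^+ 2 <= jump gam p z) ->
  nu.-integrable [set z | delta < enorm z] (fun z => (f z)%:E) ->
  (forall z, delta < enorm z -> f z <= e * jump gam p z) ->
  \int[nu]_(z in [set z | enorm z <= delta]) (e * jump gam p z)
    + \int[nu]_(z in [set z | delta < enorm z]) f z
  <= e * (Cmu - gam / 16 * \int[nu]_(z in slab eta gam p) (`|dot p z| ^+ 2)).
Proof.
move=> g1 h1 h2 e0 d1 C0 hj intf hf; have g0 : 0 < gam by lra.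
have iw := integrable_levy_weight.
have ise := integrable_slab_energy g0 h1 h2.
have ig : nu.-integrable setT (EFin \o (fun z => gam / 16 * slab_energy eta gam p z)).
  exact: (integrableZl measurableT (gam / 16) ise).
have iwg : nu.-integrable setT (EFin \o
    (fun z => levy_weight z - gam / 16 * slab_energy eta gam p z)).
  exact: (integrableB measurableT iw ig).
pose maj z := e * (levy_weight z - gam / 16 * slab_energy eta gam p z).
have im : nu.-integrable setT (EFin \o maj) by exact: (integrableZl measurableT e iwg).
set A := [set z | enorm z <= delta]; set B := [set z | delta < enorm z].
have mA : measurable (A : set (borel_rV R N)).
  by apply: measurable_le_set; [exact: measurable_enorm|exact: measurable_cst].
have mB : measurable (B : set (borel_rV R N)).
  by apply: measurable_lt_set; [exact: measurable_cst|exact: measurable_enorm].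
have AB : A `|` B = setT.
  apply/seteqP; split => // z _; rewrite /A /B /=.
  by have [|] := leP (enorm z) delta; [left|right].
have hm z : e * jump gam p z <= maj z by rewrite ler_wpM2l//; exact: jump_le.
have ij : nu.-integrable A (EFin \o (fun z => e * jump gam p z)).
  have iwC : nu.-integrable A (EFin \o (fun z => e * (C + 1) * levy_weight z)).
    apply: (integrableS measurableT) => //.
    exact: (integrableZl measurableT (e * (C + 1)) iw).
  apply: (le_integrable mA _ _ iwC).
    apply/measurable_EFinP/measurable_funTS/measurable_funM; first exact: measurable_cst.
    exact: measurable_jump.
  move=> z Az; rewrite lee_fin; have w0 := levy_weight_ge0 z.
  have eC : 0 <= e * (C + 1) by rewrite mulr_ge0//; lra.
  have CC : 0 <= C + 1 by lra.
  rewrite [leRHS]ger0_norm ?mulr_ge0//.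
  have s0 : 0 <= gam / 16 * slab_energy eta gam p z.
    by rewrite mulr_ge0 ?divr_ge0 ?(ltW g0)// /slab_energy indicE mulr_ge0 ?sqr_ge0.
  have hup := jump_le z g1 h1 h2; have hlo := hj _ Az.
  have hw : levy_weight z = enorm z ^+ 2.
    by rewrite /levy_weight (le_lt_trans Az d1).
  rewrite -hw in hlo.
  rewrite normrM (ger0_norm e0) -mulrA ler_wpM2l// ler_norml.
  have cw := mulr_ge0 C0 w0.
  by apply/andP; split; lra.
have le1 : \int[nu]_(z in A) (e * jump gam p z) <= \int[nu]_(z in A) maj z.
  by apply: (le_Rintegral mA ij (integrableS measurableT mA (@subsetT _ _) im)) => y _.
have le2 : \int[nu]_(z in B) f z <= \int[nu]_(z in B) maj z.
  apply: (le_Rintegral mB intf (integrableS measurableT mB (@subsetT _ _) im)).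
  by move=> y By; apply: le_trans (hm y); exact: hf.
apply: le_trans (lerD le1 le2) _.
rewrite -Rintegral_setU// ?AB//; last first.
  by apply/disj_setPS => z /= [] ; rewrite /A /B/= => h; rewrite ltNge h.
rewrite /maj RintegralZl// ler_wpM2l// RintegralB// RintegralZl// lerB//.
  rewrite -lee_fin fineK; last exact: integrable_fin_num.
  exact: integral_levy_weight.
rewrite [leLHS](_ : _ = gam / 16 * \int[nu]_z (slab_energy eta gam p z))//.
rewrite Rintegral_mkcond; congr (_ * _); apply: eq_Rintegral => z _.
by rewrite patchE /slab_energy indicE; case: ifP => _; rewrite ?mulr1 ?mulr0.
Qed.

End LevyIntegrals.

(** * Upper semicontinuous functions and ellipsoids *)

Section UpperSemicontinuity.
Context {R : realType} {U : topologicalType}.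
Implicit Types (S K : set U) (u f : U -> R).

Lemma continuous_near_lt f P b : continuous f -> f P < b ->
  \forall Q \near P, f Q < b.
Proof.
move=> cf fb; have := cf P [set y | y < b]; apply.
by apply: open_nbhs_nbhs; split => //; exact: open_lt.
Qed.

Lemma continuous_near_gt f P b : continuous f -> b < f P ->
  \forall Q \near P, b < f Q.
Proof.
move=> cf fb; have := cf P [set y | b < y]; apply.
by apply: open_nbhs_nbhs; split => //; exact: open_gt.
Qed.

Lemma continuous_usc S f : continuous f -> usc_on S f.
Proof.
move=> cf P _ a /(continuous_near_lt cf) h.
by rewrite /within/=; apply: filterS h => Q.
Qed.

Lemma usc_onD S u f : usc_on S u -> continuous f ->
  usc_on S (fun Q => u Q + f Q).
Proof.
move=> uu cf P SP a h; set d := (a - (u P + f P)) / 2.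
have d0 : 0 < d by rewrite divr_gt0// subr_gt0.
have h1 := uu P SP (u P + d) ltac:(lra).
have h2 := @continuous_usc S f cf P SP (f P + d) ltac:(lra).
apply: filterS2 h1 h2 => Q q1 q2.
have -> : a = (u P + d) + (f P + d) by rewrite /d; field.
by lra.
Qed.

(** An upper semicontinuous function attains its maximum on a compact set.  The
    superlevel sets of [u] at its own values in [K] form a filter base, and any
    of its cluster points is a maximum point. *)
Lemma usc_max S K u : usc_on S u -> K `<=` S -> compact K -> K !=set0 ->
  exists2 P, K P & forall Q, K Q -> u Q <= u P.
Proof.
move=> uu KS cK K0; pose B Q := [set P | K P /\ u Q <= u P].
have FF : ProperFilter (filter_from K B).
  apply: filter_from_proper; last by move=> Q KQ; exists Q; split.
  apply: filter_from_filter => // Q1 Q2 K1 K2.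
  have [h|h] := leP (u Q1) (u Q2).
    by exists Q2 => // P [KP hP]; split; split=> //; exact: le_trans hP.
  by exists Q1 => // P [KP hP]; split; split=> //; apply: le_trans hP; exact: ltW.
have FK : filter_from K B K.
  by case: K0 => Q KQ; exists Q => // P [].
have [P [KP cP]] := cK _ FF FK.
exists P => // Q KQ; rewrite leNgt; apply/negP => h.
have hn := uu P (KS _ KP) _ h.
have [|Z [[KZ hZ] hZ2]] := cP (B Q) _ _ hn; first by exists Q.
by have := hZ2 (KS _ KZ); rewrite ltNge hZ.
Qed.

Lemma closed_superlevel S u M : closed S -> usc_on S u ->
  closed [set Q | S Q /\ M <= u Q].
Proof.
move=> cS uu P hP; have SP : S P.
  by apply: cS => A /hP [Q [[SQ _] AQ]]; exists Q.
split=> //; rewrite leNgt; apply/negP => h.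
have [Z [[SZ hZ] hZ2]] := hP _ (uu P SP _ h).
by have := hZ2 SZ; rewrite ltNge hZ.
Qed.

End UpperSemicontinuity.

Section Ellipsoids.
Context {R : realType} {N : nat} (lam : R).
Context (lam0 : 0 < lam).
Implicit Types (c P Q : 'rV[R]_N * R).

Lemma closed_strip (T : R) : closed (@strip R N T).
Proof.
have -> : @strip R N T = (snd : 'rV[R]_N * R -> R) @^-1` `[0, T]%classic.
  by apply/seteqP; split => Q; rewrite /strip /= in_itv.
by apply: closed_comp; [move=> Q _; exact: cvg_snd|exact: itv_closed].
Qed.

Lemma closed_ellipsoid c (k : R) : closed [set Q | wdot lam (Q - c) (Q - c) <= k].
Proof.
have := @closed_comp _ _
  (fun Q : 'rV[R]_N * R => wdot lam (Q - c) (Q - c)) [set y | y <= k].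
apply; last exact: closed_le.
by move=> Q _; exact: sqwdot_continuous.
Qed.

Lemma compact_ellipsoid (T : R) c k :
  compact [set Q | strip T Q /\ wdot lam (Q - c) (Q - c) <= k].
Proof.
set k' := 1 + `|k|.
pose side i := `[c.1 ord0 i - k', c.1 ord0 i + k']%classic.
pose box := [set x : 'rV[R]_N | forall i, side i (x ord0 i)].
have cbox : compact (box `*` `[0, T]%classic).
  apply: compact_setX; last exact: segment_compact.
  by apply: (@rV_compact _ _ side) => i; exact: segment_compact.
apply: subclosed_compact cbox _.
  by apply: closedI; [exact: closed_strip|exact: closed_ellipsoid].
move=> Q [QT hQ]; split; last by rewrite /= in_itv.
move=> i; rewrite /side /= in_itv/= -ler_distlC.
have hk : k <= k' ^+ 2.
  have := ler_norm k; have := normr_ge0 k; rewrite /k'; nra.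
have h0 : 0 <= lam * ((Q - c).2 * (Q - c).2).
  by rewrite -expr2 mulr_ge0 ?sqr_ge0// ltW.
have h1 : enorm (Q - c).1 ^+ 2 <= k' ^+ 2.
  by rewrite sqr_enorm; move: hQ; rewrite /wdot; lra.
have k'0 : 0 <= k' by rewrite /k' addr_ge0.
rewrite ler_pXn2r ?nnegrE ?enorm_ge0// in h1.
have := coord_le_enorm (Q - c).1 i; rewrite !mxE distrC => h.
exact: le_trans h1.
Qed.

(** The ellipsoids centred at [P] form a base of neighbourhoods of [P]. *)
Lemma wball_nbhs P (A : set ('rV[R]_N * R)) : nbhs P A ->
  exists2 s, 0 < s & forall Q, wdot lam (Q - P) (Q - P) <= s -> A Q.
Proof.
move=> /nbhs_ballP[e /= e0 heA]; set d := e / 2.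
have d0 : 0 < d by rewrite divr_gt0.
exists (Num.min (d ^+ 2) (lam * d ^+ 2)).
  by rewrite lt_min !mulr_gt0 ?exprn_gt0.
move=> Q; rewrite le_min /wdot -sqr_enorm -expr2 => /andP[h1 h2].
have s1 : 0 <= enorm (Q - P).1 ^+ 2 by rewrite sqr_ge0.
have s2 : 0 <= lam * (Q - P).2 ^+ 2 by rewrite mulr_ge0 ?sqr_ge0// ltW.
have h3 : enorm (Q - P).1 <= d.
  by rewrite -(@ler_pXn2r _ 2) ?nnegrE ?enorm_ge0 ?(ltW d0)//; lra.
have h4 : `|(Q - P).2| <= d.
  rewrite -(@ler_pXn2r _ 2) ?nnegrE ?(ltW d0)// real_normK ?num_real//.
  by rewrite -(ler_pM2l lam0); lra.
apply: heA; split; rewrite /= -ball_normE /= distrC.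
  by apply: le_lt_trans (norm_le_enorm _) _; apply: le_lt_trans h3 _; rewrite /d; lra.
by apply: le_lt_trans h4 _; rewrite /d; lra.
Qed.

(** Moving the centre of an ellipsoid towards one of its boundary points gives
    a smaller ellipsoid touching the first one at that point only. *)
Lemma ellipsoid_shrink P c theta Q : 0 < theta < 1 ->
  let c' := P - theta *: (P - c) in
  wdot lam (Q - c') (Q - c') <= wdot lam (P - c') (P - c') -> Q != P ->
  wdot lam (Q - c) (Q - c) < wdot lam (P - c) (P - c).
Proof.
move=> /andP[t0 t1] c' h QP; pose q := Q - P; pose a := P - c.
have q0 : q != 0 by rewrite subr_eq0.
have eP : P - c' = theta *: a by rewrite /c' opprB addrCA subrr addr0.
have eQ : Q - c' = q + theta *: a by rewrite -eP /q addrA subrK.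
have eQc : Q - c = q + a by rewrite /q /a addrA subrK.
move: h; rewrite eP eQ eQc sqwdotD -/a sqwdotD !wdotZr !wdotZl => h.
have qq : 0 < wdot lam q q.
  rewrite lt_neqAle wdot_ge0// andbT eq_sym.
  by apply/negP => /eqP /(wdot_eq0 lam0)/eqP; rewrite (negbTE q0).
have : theta * (wdot lam q q + 2 * wdot lam q a) < theta * 0 by nra.
by rewrite ltr_pM2l//; lra.
Qed.

End Ellipsoids.

(** * Touching the subsolution by the barrier *)

Section Contact.
Context {R : realType} {N : nat} (gam lam : R) (T : R).
Context (lam0 : 0 < lam) (gam0 : 0 < gam).
Implicit Types (c P Q : 'rV[R]_N * R) (u : 'rV[R]_N * R -> R).

Lemma bump_le1 c Q : bump gam lam c Q <= 1.
Proof.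
rewrite -expR0 ler_expR mulNr oppr_le0 mulr_ge0 ?divr_ge0 ?(ltW gam0)//.
exact: wdot_ge0.
Qed.

Lemma bump_le c P Q : wdot lam (P - c) (P - c) <= wdot lam (Q - c) (Q - c) ->
  bump gam lam c Q <= bump gam lam c P.
Proof.
move=> h; rewrite ler_expR !mulNr lerN2 ler_wpM2l// divr_ge0//.
exact: ltW.
Qed.

(** Suppose that the maximum of [u] is attained at [P] and nowhere else in the
    closed ellipsoid of centre [c] through [P].  Then for small [eps] the barrier
    touches [u] from above, globally on the strip and up to a constant, at a
    point arbitrarily close to [P]. *)
Lemma barrier_touching u c P (s : R) : usc_on (strip T) u ->
  max_on (strip T) u P ->
  (forall Q, strip T Q -> wdot lam (Q - c) (Q - c) <= wdot lam (P - c) (P - c) ->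
    u Q = u P -> Q = P) -> 0 < s ->
  exists2 eps1, 0 < eps1 & forall eps, 0 < eps <= eps1 ->
    exists2 P', wdot lam (P' - P) (P' - P) <= s &
      max_on (strip T) (fun Q => u Q - barrier gam lam c eps Q) P'.
Proof.
move=> uu [SP maxP] single s0.
(* The part of the closed ellipsoid away from P, where u stays below u P by a
   positive margin eps1. *)
pose L := [set Q | (strip T Q /\ wdot lam (Q - c) (Q - c) <= wdot lam (P - c) (P - c))
   /\ s <= wdot lam (Q - P) (Q - P)].
have cL : compact L.
  have cE := @compact_ellipsoid _ _ _ lam0 T c (wdot lam (P - c) (P - c)).
  apply: subclosed_compact cE _.
    apply: closedI.
      by apply: closedI; [exact: closed_strip|exact: closed_ellipsoid].
    have := @closed_comp _ _
      (fun Q : 'rV[R]_N * R => wdot lam (Q - P) (Q - P)) [set y | s <= y].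
    apply; last exact: closed_ge.
    by move=> Q _; exact: sqwdot_continuous.
  by move=> Q [].
have [eps1 e10 he1] : exists2 eps1, 0 < eps1 & forall Q, L Q -> u Q + eps1 <= u P.
  have [L0|/set0P L0] := eqVneq L set0.
    by exists 1 => // Q; rewrite L0.
  have [Q0 [[SQ0 h1] h2] hQ0] := usc_max uu (fun Q (h : L Q) => h.1.1) cL L0.
  have Q0M : u Q0 < u P.
    rewrite lt_neqAle maxP// andbT; apply/eqP => /(single _ SQ0 h1) E.
    by move: h2; rewrite E subrr wdot0 leNgt s0.
  exists (u P - u Q0); first by rewrite subr_gt0.
  by move=> Q /hQ0; lra.
exists eps1 => // eps /andP[e0 ele].
(* Maximise u minus the barrier near P; the value at P shows that the maximum
   is global. *)
have uf : usc_on (strip T) (fun Q => u Q - barrier gam lam c eps Q).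
  apply: usc_onD => // Q.
  by apply: continuousN; exact: barrier_continuous.
have SPP : wdot lam (P - P) (P - P) <= s by rewrite subrr wdot0 ltW.
have cE := @compact_ellipsoid _ _ _ lam0 T P s.
have [|P' [SP' hP'] maxP'] := usc_max uf _ cE (ex_intro _ P (conj SP SPP)).
  by move=> Q [].
exists P' => //; split=> // Q SQ.
have [hQ|hQ] := leP (wdot lam (Q - P) (Q - P)) s; first exact: maxP'.
apply: le_trans (maxP' P (conj SP SPP)).
have b0 := bump_gt0 gam lam c; rewrite /barrier !mulNr !opprK.
have [hk|hk] := leP (wdot lam (Q - c) (Q - c)) (wdot lam (P - c) (P - c)).
  have := he1 Q (conj (conj SQ hk) (ltW hQ)).
  have h1 : eps * bump gam lam c Q <= eps * 1 by rewrite ler_wpM2l ?(ltW e0)// bump_le1.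
  have h2 : 0 < eps * bump gam lam c P by rewrite mulr_gt0.
  by lra.
rewrite lerD ?maxP// ler_wpM2l ?(ltW e0)//; apply: bump_le.
exact: ltW.
Qed.

End Contact.

(** * Horizontal propagation of maxima *)

Section Propagation.
Context {R : realType} {N : nat} (Omega : set 'rV[R]_N) (T : R).
Context (mu : 'rV[R]_N -> {measure set (borel_rV R N) -> \bar R}) (Cmu : R).
Context (hOmega : open Omega).
Context (hmuC : forall x, Omega x ->
  (\int[mu x]_(z in unit_ball) (enorm z ^+ 2)%:E
     + \int[mu x]_(z in ~` unit_ball) 1 <= Cmu%:E)%E).
Context (F : 'rV[R]_N -> R -> 'rV[R]_N -> 'M[R]_N -> R -> R).
Context (hFe : degenerate_elliptic Omega T F)
  (hN : nondegenerate Omega T Cmu mu F) (hS : scaling Omega T F).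
Context (u : 'rV[R]_N * R -> R).
Context (hu : viscosity_subsolution Omega T mu F u).

Lemma hess_sym (gam : R) (p : 'rV[R]_N) : (hess gam p)^T = hess gam p.
Proof.
by rewrite /hess linearB/= linearZ/= trmx1 trmx_mul trmxK.
Qed.

(** The viscosity inequality at a point touched from above by a barrier, after
    replacing the nonlocal term by its upper bound and dividing by [bscale].  The
    first hypothesis is the scaling condition at the base point (xb,t0). *)
Lemma viscosity_barrier (gam lam eps eta R0 eps0 gamma0 r t0 : R)
    (xb : 'rV[R]_N) (c P : 'rV[R]_N * R) :
  (forall r eps gamma : R, 0 < r < R0 -> 0 < eps < eps0 -> gamma0 <= gamma ->
    forall x t p l, near_point Omega T xb t0 r x t p ->
    eps * F x t p (hess gamma p) l
      <= F x t (eps *: p) (eps *: hess gamma p) (eps * l)) ->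
  0 < r < R0 -> gamma0 <= gam -> 1 <= gam ->
  0 < eps -> eps * gam < eps0 -> 0 < lam ->
  near_point Omega T xb t0 r P.1 P.2 (P - c).1 -> 0 < P.2 < T ->
  1 <= gam * ((1 - eta) * enorm (P - c).1) ^+ 2 ->
  1 < gam * ((1 - eta) * enorm (P - c).1) ->
  max_on (strip T) (fun Q => u Q - barrier gam lam c eps Q) P ->
  lam * (P - c).2 + F P.1 P.2 (P - c).1 (hess gam (P - c).1)
    (Cmu - 1 / 16 * gam *
       \int[mu P.1]_(z in slab eta gam (P - c).1) (`|dot (P - c).1 z| ^+ 2)) <= 0.
Proof.
move=> hscal hr g1 g2 e0 e1 lam0 np ht k1 k2 hmax.
have g0 : 0 < gam by lra.
set p := (P - c).1; set L := Cmu - _.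
have [Om tT _ _ pr] := np.
have p0 : 0 < enorm p by move: pr hr => /andP[? _] /andP[? _]; rewrite /p; lra.
have pn0 : p != 0.
  by apply: contraTneq p0 => ->; rewrite enorm0 ltxx.
set e := bscale gam lam c eps P.
have b0 := bump_gt0 gam lam c P.
have ee0 : 0 < e by rewrite mulr_gt0// mulr_gt0.
have ee1 : e < eps0.
  apply: le_lt_trans e1; rewrite -[leRHS]mulr1 ler_wpM2l ?mulr_ge0 ?(ltW e0) ?(ltW g0)//.
  exact: bump_le1.
have [delta [C [d0 d1 C0 hC]]] := jump_ge p g0.
have dd : 0 < delta < 1 by rewrite d0.
have [_ hv] := hu.
have [intf hle] := hv _ (barrier_C2 gam lam c eps (strip T)) P Om ht hmax delta dd.
move: intf hle; rewrite Dt_barrier D2x_barrier -/p -/e.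
set J := I1 _ _ _ _ + _ => intf hle.
(* Both pieces of the nonlocal term are compared with the increment of the
   barrier: the first one is its integral, the second one because u minus the
   barrier is maximal at P. *)
have hJ : J <= e * L.
  have -> : L = Cmu - gam / 16 * \int[mu P.1]_(z in slab eta gam p) (`|dot p z| ^+ 2).
    by rewrite /L; congr (_ - _ * _); field.
  rewrite /J; have -> : I1 mu delta P (barrier gam lam c eps) =
    \int[mu P.1]_(z in [set z | enorm z <= delta]) (e * jump gam p z).
    by apply: eq_Rintegral => z _; rewrite increment_barrier// gt_eqF.
  apply: (nonlocal_le (hmuC Om) g2 k1 k2 (ltW ee0) d1 C0 hC intf).
  move=> z _; rewrite -increment_barrier ?gt_eqF//.
  have := hmax.2 (P.1 + z, P.2) hmax.1.
  by rewrite /increment; lra.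
have h1 := hscal r e gam hr (introT andP (conj ee0 ee1)) g1 _ _ _ L np.
have h2 : F P.1 P.2 (e *: p) (e *: hess gam p) (e * L) <=
    F P.1 P.2 (e *: p) (e *: hess gam p) J.
  have sX : (e *: hess gam p)^T = e *: hess gam p by rewrite linearZ/= hess_sym.
  apply: hFe => //.
    by rewrite scaler_eq0 negb_or gt_eqF.
  by move=> v; rewrite subrr mulmx0 mul0mx mxE.
rewrite Dx_barrier -/p -/e in hle.
have : e * (lam * (P - c).2 + F P.1 P.2 p (hess gam p) L) <= e * 0.
  by rewrite mulr0 mulrDr; apply: le_trans hle; rewrite lerD2l; exact: le_trans h2.
by rewrite ler_pM2l.
Qed.

(** A maximum point of [u] cannot lie on the lateral boundary of an ellipsoid
    inside which [u] is below its maximum. *)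
Lemma no_lateral_contact (lam : R) (c1 P : 'rV[R]_N * R) : 0 < lam ->
  Omega P.1 -> 0 < P.2 < T -> max_on (strip T) u P -> P.1 != c1.1 ->
  (forall Q, strip T Q ->
    wdot lam (Q - c1) (Q - c1) < wdot lam (P - c1) (P - c1) -> u Q < u P) ->
  False.
Proof.
move=> lam0 OP tP hmax Pc hin.
have [R1 [R10 [eta [/andP[eta0 eta1] hN']]]] := hN OP tP.
have [R2 [eps0 [gamma0 [R20 eps00 gamma00 hS']]]] := hS OP tP.
(* The new centre is P - theta a, with theta small enough that the radius r of
   the two structure conditions is below their thresholds; the space component
   theta a.1 has norm 3/4 r, strictly between r/2 and r. *)
pose a := P - c1; have na : 0 < enorm a.1 by rewrite enorm_gt0// subr_eq0.
pose R0 := Num.min R1 R2; have R00 : 0 < R0 by rewrite lt_min R10.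
pose theta := Num.min (1 / 2) (R0 / (2 * enorm a.1)).
have th0 : 0 < theta by rewrite lt_min !divr_gt0// mulr_gt0.
have th1 : theta <= 1 / 2 by rewrite ge_min lexx.
have th2 : theta * (2 * enorm a.1) <= R0.
  by rewrite -ler_pdivlMr ?mulr_gt0// ge_min lexx orbT.
pose r := 4 / 3 * (theta * enorm a.1).
have tn0 : 0 < theta * enorm a.1 by rewrite mulr_gt0.
have r0 : 0 < r by rewrite /r; lra.
have rR0 : r < R0 by rewrite /r; lra.
have [rR1 rR2] : r < R1 /\ r < R2 by move: rR0; rewrite lt_min => /andP.
pose c := P - theta *: a.
have Pc' : P - c = theta *: a by rewrite /c opprB addrCA subrr addr0.
have nPc : enorm (P - c).1 = 3 / 4 * r.
  by rewrite Pc' enormZ gtr0_norm// /r; field.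
(* a neighbourhood of the contact point on which all conditions hold *)
pose good Q := near_point Omega T P.1 P.2 r Q.1 Q.2 (Q - c).1 /\ 0 < Q.2 < T.
have [s s0 hgood] : exists2 s, 0 < s &
    forall Q, wdot lam (Q - P) (Q - P) <= s -> good Q.
  apply: wball_nbhs => //.
  have c2 : continuous (snd : 'rV[R]_N * R -> R) by move=> Q; exact: cvg_snd.
  have ce := @dist_fst_continuous R N.
  have n1 : \forall Q \near P, Omega Q.1.
    by apply: cvg_fst; exact: open_nbhs_nbhs.
  have [t1 t2] : 0 < P.2 /\ P.2 < T by apply/andP.
  have n2 : \forall Q \near P, 0 < Q.2 by exact: (continuous_near_gt c2).
  have n3 : \forall Q \near P, Q.2 < T by exact: (continuous_near_lt c2).
  have n4 : \forall Q \near P, P.2 - r < Q.2.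
    by apply: (continuous_near_gt c2); rewrite ltrBlDr ltrDl.
  have n5 : \forall Q \near P, Q.2 < P.2 + r.
    by apply: (continuous_near_lt c2); rewrite ltrDl.
  have n6 : \forall Q \near P, enorm (Q.1 - P.1) < r.
    by apply: (continuous_near_lt (ce _)); rewrite /= subrr enorm0.
  have n7 : \forall Q \near P, enorm (Q.1 - c.1) < r.
    by apply: (continuous_near_lt (ce _)); rewrite -/(P - c).1 nPc; lra.
  have n8 : \forall Q \near P, r / 2 < enorm (Q.1 - c.1).
    by apply: (continuous_near_gt (ce _)); rewrite -/(P - c).1 nPc; lra.
  near=> Q.
  have q1 : Omega Q.1 by near: Q.
  have q2 : 0 < Q.2 by near: Q.
  have q3 : Q.2 < T by near: Q.
  have q4 : P.2 - r < Q.2 by near: Q.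
  have q5 : Q.2 < P.2 + r by near: Q.
  have q6 : enorm (Q.1 - P.1) < r by near: Q.
  have q7 : enorm (Q.1 - c.1) < r by near: Q.
  have q8 : r / 2 < enorm (Q.1 - c.1) by near: Q.
  split; last by rewrite q2.
  split; [exact: q1|by rewrite !ltW|exact: ltW| |by rewrite !ltW].
  by rewrite ler_norml; apply/andP; split; lra.
(* An upper bound for the time derivative of the barrier divided by its scale,
   plus 1. *)
pose Abound := lam * (r + `|(P - c).2|) + 1.
have rR1' : 0 < r < R1 by rewrite r0.
have hA := hN' r (1 / 16) rR1' ltac:(lra) Abound.
pose k := (1 - eta) * (r / 2); have k0 : 0 < k by rewrite mulr_gt0//; lra.
have [gam gbig hgam] := pinfty_ex_gt (num_real (gamma0 + 1 + k^-1 ^+ 2 + k^-1)) hA.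
have ki0 : 0 < k^-1 by rewrite invr_gt0.
have ki2 : 0 < k^-1 ^+ 2 by rewrite exprn_gt0.
have g0 : 0 < gam by lra.
have b1 : 1 <= gam * k ^+ 2.
  by rewrite -ler_pdivrMr ?exprn_gt0// div1r -exprVn; lra.
have b2 : 1 < gam * k by rewrite -ltr_pdivrMr// div1r; lra.
have single Q : strip T Q ->
    wdot lam (Q - c) (Q - c) <= wdot lam (P - c) (P - c) -> u Q = u P -> Q = P.
  move=> SQ hQ uQ; apply/eqP; apply: contraT => QP.
  have th : 0 < theta < 1 by rewrite th0/=; lra.
  by have := hin Q SQ (ellipsoid_shrink lam0 th hQ QP); rewrite uQ ltxx.
have [eps1 e10 htouch] := barrier_touching lam0 g0 hu.1 hmax single s0.
pose eps := Num.min eps1 (eps0 / (2 * gam)).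
have ee0 : 0 < eps by rewrite lt_min e10 divr_gt0// mulr_gt0.
have ee1 : eps <= eps1 by rewrite ge_min lexx.
have ee2 : eps * gam < eps0.
  have : eps * (2 * gam) <= eps0 by rewrite -ler_pdivlMr ?mulr_gt0// ge_min lexx orbT.
  by have := mulr_gt0 ee0 g0; lra.
have [P' hP' hmax'] := htouch eps (introT andP (conj ee0 ee1)).
have [np tP'] := hgood _ hP'.
have [_ _ _ tt /andP[pr _]] := np.
have kle : k <= (1 - eta) * enorm (P' - c).1 by rewrite ler_wpM2l//; lra.
have rR2' : 0 < r < R2 by rewrite r0.
have := viscosity_barrier hS' rR2' _ _ ee0 ee2 lam0 np tP' _ _ hmax'.
have hF := hgam _ _ _ np.
move=> /(_ eta) hfin.
have : lam * (P' - c).2 + F P'.1 P'.2 (P' - c).1 (hess gam (P' - c).1)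
    (Cmu - 1 / 16 * gam *
       \int[mu P'.1]_(z in slab eta gam (P' - c).1) (`|dot (P' - c).1 z| ^+ 2)) <= 0.
  apply: hfin; [lra|lra| |].
    apply: le_trans b1 _; rewrite ler_wpM2l ?(ltW g0)//.
    by rewrite ler_pXn2r ?nnegrE ?(ltW k0)// (le_trans (ltW k0)).
  by apply: lt_le_trans b2 _; rewrite ler_wpM2l ?(ltW g0).
have : - (lam * (r + `|(P - c).2|)) <= lam * (P' - c).2.
  rewrite -mulrN ler_wpM2l ?(ltW lam0)//.
  have : (P' - c).2 = (P'.2 - P.2) + (P - c).2 by rewrite /=; ring.
  move: tt; rewrite ler_norml => /andP[tt1 _].
  have := ler_norm (- (P - c).2); rewrite normrN; lra.
by move: hF; rewrite /Abound; lra.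
Unshelve. all: by end_near. Qed.

(** The set where [u] is maximal is open in horizontal slices. *)
Lemma local_propagation (x0 : 'rV[R]_N) (t0 : R) : Omega x0 -> 0 < t0 < T ->
  max_on (strip T) u (x0, t0) ->
  exists2 rho : R, 0 < rho &
    forall x1, enorm (x1 - x0) < rho -> u (x1, t0) = u (x0, t0).
Proof.
move=> Ox0 ht0 [S0 max0]; have [t00 t0T] := andP ht0.
have uu := hu.1.
have [rho rho0 hrho] : exists2 rho : R, 0 < rho &
    forall x, enorm (x - x0) < 2 * rho -> Omega x.
  have : nbhs x0 Omega by exact: open_nbhs_nbhs.
  move=> /nbhs_ballP[e /= e0 he]; exists (e / 2); first by rewrite divr_gt0.
  move=> x hx; apply: he; rewrite -ball_normE /= distrC.
  by apply: le_lt_trans (norm_le_enorm _) _; lra.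
exists rho => // x1 hx1.
have S1 : strip T (x1, t0) by rewrite /strip/= !ltW.
have [//|un] := eqVneq (u (x1, t0)) (u (x0, t0)).
have ult : u (x1, t0) < u (x0, t0) by rewrite lt_neqAle un max0.
exfalso.
(* By semicontinuity u stays below its maximum on a vertical segment through
   (x1,t0). *)
have [s s0 hs] : exists2 s : R, 0 < s & forall t, `|t - t0| < s ->
    0 < t < T /\ u (x1, t) < u (x0, t0).
  have := uu _ S1 _ ult; rewrite /within/= => /(wball_nbhs (@ltr01 R))[s s0 hs].
  have q0 : 0 < Num.sqrt s by rewrite sqrtr_gt0.
  exists (Num.min (Num.sqrt s) (Num.min t0 (T - t0))).
    by rewrite !lt_min q0 t00 subr_gt0.
  move=> t; rewrite !lt_min => /and3P[h1 h2 h3].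
  move: h2 h3; rewrite !ltr_norml => /andP[h2 _] /andP[_ h3].
  have tT : 0 < t < T by apply/andP; split; lra.
  split=> //; apply: hs; last by rewrite /strip/=; move: tT => /andP[? ?]; rewrite !ltW.
  rewrite /wdot/= subrr dot0 add0r mul1r.
  rewrite -expr2 -real_normK ?num_real// -(sqr_sqrtr (ltW s0)).
  by rewrite ler_pXn2r ?nnegrE ?(ltW q0)// ltW.
(* An ellipsoid of space radius at most rho then has time radius at most s. *)
pose lam := rho ^+ 2 / s ^+ 2.
have lam0 : 0 < lam by rewrite divr_gt0 ?exprn_gt0.
pose c1 := (x1, t0).
have d0 : wdot lam ((x0, t0) - c1) ((x0, t0) - c1) = enorm (x0 - x1) ^+ 2.
  by rewrite /wdot/= subrr !mulr0 addr0 sqr_enorm.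
have d1 : enorm (x0 - x1) ^+ 2 < rho ^+ 2.
  rewrite ltr_pXn2r ?nnegrE ?enorm_ge0 ?(ltW rho0)//.
  by rewrite -opprB -scaleN1r enormZ normrN1 mul1r.
(* The maximum points of u in the ellipsoid of centre c1 through (x0,t0); one
   that is closest to c1 is a lateral contact point. *)
pose K := [set Q | (strip T Q /\ wdot lam (Q - c1) (Q - c1) <= enorm (x0 - x1) ^+ 2)
  /\ (strip T Q /\ u (x0, t0) <= u Q)].
have cK : compact K.
  have cE := @compact_ellipsoid _ _ _ lam0 T c1 (enorm (x0 - x1) ^+ 2).
  apply: subclosed_compact cE _; last by move=> Q [].
  apply: closedI; first by apply: closedI; [exact: closed_strip|exact: closed_ellipsoid].
  by apply: closed_superlevel => //; exact: closed_strip.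
have K0 : K !=set0 by exists (x0, t0); split; split => //; rewrite d0.
have cd : usc_on (strip T) (fun Q => - wdot lam (Q - c1) (Q - c1)).
  by apply: continuous_usc => Q; apply: (@continuousN _ _ _ (fun Q : 'rV[R]_N * R =>
    wdot lam (Q - c1) (Q - c1))); exact: sqwdot_continuous.
have [|P [[SP hP1] [_ hP2]] minP] := usc_max cd _ cK K0; first by move=> Q [[]].
have uP : u P = u (x0, t0) by apply/eqP; rewrite eq_le hP2 max0.
have hP : enorm (P.1 - x1) ^+ 2 + lam * (P.2 - t0) ^+ 2 < rho ^+ 2.
  by apply: le_lt_trans d1; move: hP1; rewrite /wdot -sqr_enorm (expr2 (P.2 - t0)).
have e0 := sqr_ge0 (enorm (P.1 - x1)).
have l0 : 0 <= lam * (P.2 - t0) ^+ 2 by rewrite mulr_ge0 ?sqr_ge0// ltW.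
have tP : `|P.2 - t0| < s.
  rewrite -(@ltr_pXn2r _ 2) ?nnegrE ?(ltW s0)// real_normK ?num_real//.
  rewrite -(ltr_pM2l lam0) [X in _ < X](_ : _ = rho ^+ 2); first by lra.
  by rewrite /lam divfK// gt_eqF ?exprn_gt0.
have [tPT uPlt] := hs _ tP.
apply: (@no_lateral_contact lam c1 P lam0 _ tPT).
- apply: hrho; rewrite -(@ltr_pXn2r _ 2) ?nnegrE ?enorm_ge0 ?mulr_ge0 ?(ltW rho0)//.
  (* |v + w|^2 <= 2 |v|^2 + 2 |w|^2 *)
  have -> : P.1 - x0 = (P.1 - x1) + (x1 - x0) by rewrite addrA subrK.
  have h2 : dot (P.1 - x1) (P.1 - x1) < rho ^+ 2 by rewrite -sqr_enorm; lra.
  have h3 : dot (x1 - x0) (x1 - x0) < rho ^+ 2.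
    by rewrite -sqr_enorm ltr_pXn2r ?nnegrE ?enorm_ge0 ?(ltW rho0).
  have := dot_ge0 ((P.1 - x1) - (x1 - x0)); rewrite sqr_enorm.
  move: h2 h3; move: (P.1 - x1) (x1 - x0) => v w h2 h3.
  rewrite -scaleN1r !dotDl !dotDr !dotZl !dotZr (dotC w v); nra.
- by split=> // Q SQ; rewrite uP max0.
- apply/eqP => /= E; move: uPlt.
  by rewrite (_ : (x1, P.2) = P) ?uP ?ltxx// -E -surjective_pairing.
move=> Q SQ hQ; rewrite uP lt_neqAle max0// andbT; apply/eqP => E.
have KQ : K Q by split; split => //; rewrite ?E//; apply: le_trans (ltW hQ) _.
by have := minP Q KQ; rewrite lerN2 leNgt hQ.
Qed.

End Propagation.

Theorem theorem7 (R : realType) (N : nat) (Omega : set 'rV[R]_N) (T : R)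
  (hOmega : open Omega) (hbOmega : bounded_set Omega) (hT : 0 < T)
  (mu : 'rV[R]_N -> {measure set (borel_rV R N) -> \bar R})
  (hmu : levy_family Omega mu)
  (Cmu : R) (hCmu : 0 < Cmu)
  (hmuC : forall x, Omega x ->
     (\int[mu x]_(z in unit_ball) (enorm z ^+ 2)%:E
        + \int[mu x]_(z in ~` unit_ball) 1 <= Cmu%:E)%E)
  (F : 'rV[R]_N -> R -> 'rV[R]_N -> 'M[R]_N -> R -> R)
  (hFc : continuous_operator Omega T F)
  (hFe : degenerate_elliptic Omega T F)
  (hN : nondegenerate Omega T Cmu mu F)
  (hS : scaling Omega T F)
  (u : 'rV[R]_N * R -> R)
  (husc : usc_on (strip T) u)
  (hu : viscosity_subsolution Omega T mu F u)
  (P0 : 'rV[R]_N * R) (hP0 : cylinder Omega T P0)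
  (hP0T : P0.2 < T)
  (hmax : max_on (strip T) u P0) :
  forall P, connected_component (Omega `*` [set P0.2]) P0 P -> u P = u P0.
Proof.
move=> P [B [BP0 BO cB] BP].
have t0 : 0 < P0.2 < T by case: hP0 => _ /andP[-> _].
have BS Q : B Q -> strip T Q /\ Q.2 = P0.2.
  move=> /BO [_ /= E]; split=> //; rewrite /strip/= E.
  by move: t0 => /andP[? ?]; rewrite !ltW.
pose W := B `&` [set Q | u Q = u P0].
suff : W = B by move=> WB; have [] : W P by rewrite WB.
apply: cB; first by exists P0.
- exists ([set Q | Q.2 = P0.2 -> u Q = u P0]°); first exact: open_interior.
  apply/seteqP; split => Q [BQ hQ]; split=> //; last first.
    by have := interior_subset hQ; apply; exact: (BS _ BQ).2.
  have [OQ /= tQ] := BO _ BQ; have [SQ _] := BS _ BQ.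
  have hmaxQ : max_on (strip T) u (Q.1, P0.2).
    rewrite -tQ -surjective_pairing; split=> // Z SZ.
    by rewrite hQ; exact: hmax.2.
  have [rho rho0 hrho] := local_propagation hOmega hmuC hFe hN hS hu OQ t0 hmaxQ.
  have : nbhs Q [set Z : 'rV[R]_N * R | enorm (Z.1 - Q.1) < rho].
    apply: (continuous_near_lt (@dist_fst_continuous R N Q.1)).
    by rewrite /= subrr enorm0.
  apply: filterS => Z hZ tZ; rewrite (surjective_pairing Z) tZ hrho//.
  by rewrite -tQ -surjective_pairing.
exists [set Q | strip T Q /\ u P0 <= u Q].
  by apply: closed_superlevel => //; exact: closed_strip.
apply/seteqP; split => Q [BQ hQ]; split=> //.
  by split; [exact: (BS _ BQ).1|rewrite hQ].
by apply/eqP; rewrite eq_le hQ.2 hmax.2//; exact: (BS _ BQ).1.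
Qed.
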